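(* For every $\theta\in\Theta$, the Lasso-based set $$\hat J_L(\theta)=\{j=1,\dots,p:\ \hat\mu_{j,L}(\theta)/\hat\sigma_j(\theta)\ge-\lambda_n\}$$ can be equivalently expressed as $$\hat J_L(\theta)=\{j=1,\dots,p:\ \hat\mu_j(\theta)/\hat\sigma_j(\theta)\ge-3\lambda_n/2\}.$$
   Context: For each $\theta\in\Theta$, $X_1(\theta),\dots,X_n(\theta)$ are random vectors in $\mathbb R^k$ with components $X_{ij}(\theta)$, $1\le p\le k$; $\hat\mu_j(\theta)=n^{-1}\sum_iX_{ij}(\theta)$, $\hat\sigma_j(\theta)\ge 0$ with $\hat\sigma_j^2(\theta)=n^{-1}\sum_i(X_{ij}(\theta)-\hat\mu_j(\theta))^2$. Convention: $x/0=\infty\cdot1[x>0]-\infty\cdot1[x<0]$ (with $0\cdot\infty=0$). $\lambda_n>0$ is a penalization parameter. The (weighted) Lasso estimator of the vector of inequality moments is, componentwise for $j=1,\dots,p$, $$\hat\mu_{j,L}(\theta)=\arg\min_{m\in\mathbb R}\{(\hat\mu_j(\theta)-m)^2+\lambda_n\hat\sigma_j(\theta)|m|\}.$$ *)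

(* Defs.v *)
From HB Require Import structures.
From mathcomp Require Import all_boot all_order all_algebra.
From mathcomp Require Import all_classical all_reals all_analysis.
Set Implicit Arguments.
Unset Strict Implicit.
Unset Printing Implicit Defensive.
Import Order.TTheory GRing.Theory Num.Theory.
Local Open Scope classical_set_scope.
Local Open Scope ring_scope.

Section SampleMoments.
Context {R : realType} {n k : nat}.
Implicit Types (x : 'I_n -> 'I_k -> R) (j : 'I_k) (lambda : R) (p : nat).

Definition mu_hat x j : R := n%:R^-1 * \sum_(i < n) x i j.

Definition sigma_hat x j : R :=
  Num.sqrt (n%:R^-1 * \sum_(i < n) (x i j - mu_hat x j) ^+ 2).

Definition minimizers (f : R -> R) : set R :=
  [set m | forall m', f m <= f m'].

(* An arbitrary minimizer, which is "the" minimizer when it exists and is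
   unique; the default value 0 is taken only if there is no minimizer. *)
Definition argmin (f : R -> R) : R := xget 0 (minimizers f).

Definition mu_lasso lambda x j : R :=
  argmin (fun m => (mu_hat x j - m) ^+ 2 + lambda * sigma_hat x j * `|m|).

(* The quotients below are taken in \bar R because sigma_hat may vanish. *)
Lemma ediv0 (y : R) :
  (y%:E / 0%:E = +oo * (0 < y)%R%:R%:E - +oo * (y < 0)%R%:R%:E)%E.
Proof.
rewrite inver eqxx muleC; case: (ltgtP y 0) => [y0|y0|->] /=.
- by rewrite mule0 sub0e mule1 lt0_mulye// lte_fin.
- by rewrite mule0 sube0 mule1 gt0_mulye// lte_fin.
- by rewrite !mule0 sube0.
Qed.

(* Components are indexed from 0, so that the inequality moments, the first p
   of the k components, are those with index j < p. *)
Definition J_lasso p lambda x : set 'I_k :=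
  [set j : 'I_k | (j < p)%N /\
    ((- lambda)%:E <= (mu_lasso lambda x j)%:E / (sigma_hat x j)%:E)%E].

End SampleMoments.

(* Main.v *)
Require Import Defs.
From HB Require Import structures.
From mathcomp Require Import all_boot all_order all_algebra.
From mathcomp Require Import all_classical all_reals all_analysis.
From mathcomp Require Import lra.
Set Implicit Arguments.
Unset Strict Implicit.
Unset Printing Implicit Defensive.
Import Order.TTheory GRing.Theory Num.Theory.
Local Open Scope classical_set_scope.
Local Open Scope ring_scope.

(** The penalized criterion [(a - m) ^+ 2 + c * `|m|] is minimized by shrinking
    [a] towards [0] by [c / 2]: this is soft thresholding ([argmin_lasso]). With
    [c = lambda_n * sigma], the shrunk value is at least [- c] iff [a] is at
    least [- c - c / 2] ([soft_threshold_geN]), because only negative values of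
    [a] matter and these are moved up by [c / 2] (or stopped at [0]). Dividing by
    [sigma > 0] turns [- c] and [- 3 * c / 2] into the two cut-offs of the theorem.
    When [sigma = 0] there is no penalty, so the Lasso estimator is the sample
    mean itself; its quotient by [0] is [+oo], [0] or [-oo], so that it reaches a
    negative real cut-off iff the mean is nonnegative, whatever the cut-off
    ([lee_ediv0]). *)

Section SoftThresholding.
Context {R : realType}.
Implicit Types a b c m y s : R.

Definition soft_threshold b a : R :=
  if b < a then a - b else if a < - b then a + b else 0.

(** Twice the residual [a - soft_threshold (c / 2) a] is a subgradient of
    [c * `|m|] at the soft threshold, which cancels the first-order variation of
    the quadratic part and leaves its second-order term, the squared distance.
    Keeping this square yields minimality and uniqueness at once. *)
Lemma lasso_quadratic_growth c a m : 0 <= c ->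
  let s := soft_threshold (c / 2) a in
  (a - s) ^+ 2 + c * `|s| + (m - s) ^+ 2 <= (a - m) ^+ 2 + c * `|m|.
Proof.
move=> c0; rewrite /soft_threshold /=.
have cm : c * m <= c * `|m| by rewrite ler_wpM2l// ler_norm.
have cNm : - (c * m) <= c * `|m| by rewrite -mulrN ler_wpM2l// -normrN ler_norm.
case: ltP => [ac|ca].
  by rewrite (ger0_norm (_ : 0 <= a - c / 2)); [nra|lra].
case: ltP => [ac|ac]; first by rewrite (ler0_norm (_ : a + c / 2 <= 0)); [nra|lra].
(* Here the residual is [a] itself, and [`|2 * a| <= c]. *)
rewrite normr0 mulr0 !subr0.
have am : 2 * a * m <= c * `|m|.
  rewrite (le_trans (ler_norm _))// normrM ler_wpM2r// ler_norml.
  by apply/andP; split; lra.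
nra.
Qed.

Lemma argmin_lasso c a : 0 <= c ->
  argmin (fun m => (a - m) ^+ 2 + c * `|m|) = soft_threshold (c / 2) a.
Proof.
move=> c0; have growth m := lasso_quadratic_growth a m c0.
apply: xget_unique => [m|m m_min] /=.
  by apply: le_trans (growth m); rewrite lerDl sqr_ge0.
have /= mm := growth m.
have /= ms := m_min (soft_threshold (c / 2) a).
have d0 : (m - soft_threshold (c / 2) a) ^+ 2 <= 0 by lra.
by apply/eqP; rewrite -subr_eq0 -sqrf_eq0 eq_le d0 sqr_ge0.
Qed.

Lemma soft_threshold0 a : soft_threshold 0 a = a.
Proof. by rewrite /soft_threshold oppr0 addr0; case: ltgtP. Qed.

Lemma soft_threshold_geN c a : 0 <= c ->
  (- c <= soft_threshold (c / 2) a) = (- (3 * c / 2) <= a).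
Proof.
move=> c0; rewrite /soft_threshold.
by case: ltP => ?; [|case: ltP => ?]; apply/idP/idP; lra.
Qed.

Lemma lee_ediv_pos b y s : 0 < s ->
  (b%:E <= y%:E / s%:E)%E = (b * s <= y).
Proof. by move=> s0; rewrite inver gt_eqF// -EFinM lee_fin ler_pdivlMr. Qed.

Lemma lee_ediv0 b y : b < 0 -> (b%:E <= y%:E / 0%:E)%E = (0 <= y).
Proof.
move=> b0; rewrite ediv0; case: (ltgtP y 0) => [y0|y0|y0] /=.
- by rewrite mule0 sub0e mule1.
- by rewrite mule0 sube0 mule1 leey.
- by rewrite !mule0 sube0 lee_fin ltW.
Qed.

End SoftThresholding.

Theorem lemma3p2 (R : realType) (d : measure_display)
    (Omega : measurableType d) (P : probability Omega R)
    (Theta : Type) (n k p : nat)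
    (n_gt0 : (0 < n)%N) (p_gt0 : (0 < p)%N) (p_le_k : (p <= k)%N)
    (X : Theta -> 'I_n -> 'I_k -> {RV P >-> R})
    (lambda_n : R) (lambda_gt0 : 0 < lambda_n) :
  forall (theta : Theta) (omega : Omega),
    let x := fun i j => X theta i j omega in
    J_lasso p lambda_n x =
    [set j : 'I_k | (j < p)%N /\
      ((- (3 * lambda_n / 2))%:E <= (mu_hat x j)%:E / (sigma_hat x j)%:E)%E].
Proof.
move=> theta omega x; clearbody x.
suff cutoffs j :
    ((- lambda_n)%:E <= (mu_lasso lambda_n x j)%:E / (sigma_hat x j)%:E)%E =
    ((- (3 * lambda_n / 2))%:E <= (mu_hat x j)%:E / (sigma_hat x j)%:E)%E.
  by apply/funext => j; rewrite /J_lasso /mkset cutoffs.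
have sigma_ge0 : 0 <= sigma_hat x j by exact: sqrtr_ge0.
have c_ge0 : 0 <= lambda_n * sigma_hat x j by rewrite mulr_ge0// ltW.
rewrite /mu_lasso argmin_lasso//.
have [sigma0|sigma_neq0] := eqVneq (sigma_hat x j) 0.
  by rewrite sigma0 mulr0 mul0r soft_threshold0 !lee_ediv0//; lra.
have sigma_gt0 : 0 < sigma_hat x j by rewrite lt_def sigma_neq0.
by rewrite !lee_ediv_pos// mulNr soft_threshold_geN//; congr (_ <= _); lra.
Qed.
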